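(* Let $G$ be a connected real simple Lie group with finite center whose maximal compact subgroup $K$ has non-discrete center. Let $G = KAN$ be the Iwasawa decomposition, $S = AN$, and let $\mathfrak{e} = \mathfrak{k}^0 \rtimes \mathfrak{k}$ be equipped with the Lie bialgebra structure with cobracket $\delta$ associated with the matched pair $(K, S)$ in $G$. Then the Lie bialgebra $\mathfrak{e}$ is coboundary. More precisely, if $z$ is an element spanning the center $\mathcal{Z}(\mathfrak{k})$ of $\mathfrak{k}$ normalized so that $\mathrm{ad}(z)^2|_{\mathfrak{p}} = -1$, then $r = z.\delta(z)$ satisfies $\delta(x) = [r, \Delta(x)]$ for all $x \in \mathfrak{e}$.
   Context: $\mathfrak{g}, \mathfrak{k}, \mathfrak{s}$ denote the real Lie algebras of $G, K, S$. $\mathfrak{g} = \mathfrak{k}\oplus\mathfrak{p}$ is the Cartan decomposition for $K \subset G$ (orthogonal for the Killing form), with respect to which the Iwasawa decomposition $G = KAN$ is taken. Under the hypotheses, $\mathcal{Z}(\mathfrak{k})$ is $1$-dimensional and it is known that it has a spanning element $z$ with $\mathrm{ad}(z)^2|_{\mathfrak{p}} = -1$. The Iwasawa decomposition gives $\mathfrak{g} = \mathfrak{k} \oplus \mathfrak{s}$ as a vector space; let $P^I_{\mathfrak{k}}\colon \mathfrak{g}\to\mathfrak{k}$ be the corresponding projection (along $\mathfrak{s}$). $\mathfrak{k}^0 \subset \mathfrak{g}^*$ is the annihilator of $\mathfrak{k}$; it is dual to $\mathfrak{s}$ by restricting the pairing of $\mathfrak{g}^*$ and $\mathfrak{g}$.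 The coadjoint action is $\langle \mathrm{ad}^\vee(x)(\phi), y\rangle = -\langle \phi, [x,y]\rangle$, and $\mathfrak{k}^0$ is invariant under $\mathrm{ad}^\vee(\mathfrak{k})$. The Lie algebra $\mathfrak{e} = \mathfrak{k}^0 \rtimes \mathfrak{k}$ is the vector space $\mathfrak{k}^0 \oplus \mathfrak{k}$ with the bracket of $\mathfrak{k}$ on $\mathfrak{k}$, $[x,\psi] = \mathrm{ad}^\vee(x)(\psi)$ for $x\in\mathfrak{k}$, $\psi\in\mathfrak{k}^0$, and $[\psi,\psi'] = 0$ for $\psi,\psi'\in\mathfrak{k}^0$. The wedge product is $a\wedge b = a\otimes b - b\otimes a$. The cobracket $\delta\colon \mathfrak{e}\to \bigwedge^2\mathfrak{e}\subset\mathfrak{e}\otimes\mathfrak{e}$ is the one obtained by differentiating the Poisson--Lie structure on $E = \mathfrak{k}^0\rtimes K$ coming from the Lie algebroid of the matched pair $(K,S)$; explicitly, with $(y_i)_i$ a basis of $\mathfrak{s}$ and $(\psi^i)_i$ the dual basis of $\mathfrak{k}^0$, $$\delta(x) = \sum_i P^I_{\mathfrak{k}}[y_i, x]\wedge\psi^i \quad (x\in\mathfrak{k}),$$ and for $\psi\in\mathfrak{k}^0$, $\delta(\psi)\in\mathfrak{k}^0\otimes\mathfrak{k}^0$ is characterized by $\langle\delta(\psi), y\otimes y'\rangle = \langle\psi,[y,y']\rangle$ for $y,y'\in\mathfrak{s}$. This $\delta$ is a Lie bialgebra cobracket on $\mathfrak{e}$. Notation: for $x\in\mathfrak{e}$ and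 $t\in\mathfrak{e}\otimes\mathfrak{e}$, $x.t = (\mathrm{ad}(x)\otimes\mathrm{id} + \mathrm{id}\otimes\mathrm{ad}(x))(t)$; $\Delta(x) = x\otimes 1 + 1\otimes x$, and $[t,\Delta(x)] = -x.t$ (commutator in $U(\mathfrak{e})\otimes U(\mathfrak{e})$). A Lie bialgebra $(\mathfrak{e},\delta)$ is coboundary if there is $r\in\bigwedge^2\mathfrak{e}$ with $\delta(x) = [r,\Delta(x)]$ for all $x\in\mathfrak{e}$. *)

(* Defs.v *)
From HB Require Import structures.
From mathcomp Require Import all_boot all_order all_algebra.
From mathcomp Require Import all_classical all_reals all_analysis.
From mathcomp Require Import ring.

Set Implicit Arguments.
Unset Strict Implicit.
Unset Printing Implicit Defensive.

Import Order.TTheory GRing.Theory Num.Theory.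
Import numFieldNormedType.Exports.
Import passmx.

Local Open Scope classical_set_scope.
Local Open Scope ring_scope.

HB.mixin Record Vector_isLieAlgebra (F : fieldType) L of Vector F L := {
  lie : L -> L -> L;
  lie_linearl : forall y, linear (lie^~ y);
  lie_linearr : forall x, linear (lie x);
  liexx : forall x, lie x x = 0;
  lie_jacobi : forall x y z,
    lie x (lie y z) + lie y (lie z x) + lie z (lie x y) = 0
}.

#[short(type="lieAlgType")]
HB.structure Definition LieAlgebra (F : fieldType) :=
  {L of Vector F L & Vector_isLieAlgebra F L}.

Section LieTheory.
Variables (F : fieldType) (L : lieAlgType F).
Implicit Types (x y z : L) (U : {vspace L}).

HB.instance Definition _ x := GRing.isSemilinear.Build F L L _ (lie x)
  (GRing.semilinear_linear (lie_linearr x)).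

Lemma lieDl y x x' : lie (x + x') y = lie x y + lie x' y.
Proof. by have := lie_linearl y 1 x x'; rewrite !scale1r. Qed.

Lemma lie0l y : lie 0 y = 0 :> L.
Proof. by apply: (addrI (lie 0 y)); rewrite -lieDl !addr0. Qed.

Lemma lieZl c x y : lie (c *: x) y = c *: lie x y.
Proof. by have := lie_linearl y c x 0; rewrite lie0l !addr0. Qed.

Lemma lieC x y : lie x y = - lie y x.
Proof.
apply/eqP; rewrite -addr_eq0; have := liexx (x + y).
by rewrite lieDl !linearD /= !liexx add0r addr0 => ->.
Qed.

Lemma lie_jacobi_act x y z :
  lie (lie x y) z = lie x (lie y z) - lie y (lie x z).
Proof.
apply/esym/eqP; rewrite -subr_eq0 -[- lie (lie x y) z]lieC.
by rewrite [lie x z]lieC linearN opprK lie_jacobi.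
Qed.

Definition ad x : 'End(L) := linfun (lie x).

Lemma adE x y : ad x y = lie x y. Proof. by rewrite lfunE. Qed.

Definition killing_form x y : F :=
  \tr (mxof (vbasis {:L}) (vbasis {:L}) (ad x \o ad y)%VF).

Definition lie_simple : Prop :=
  (exists x y, lie x y != 0) /\
  (forall I : {vspace L}, (forall x y, y \in I -> lie x y \in I) ->
    I = 0%VS \/ I = fullv).

Record lieSubalg := LieSubalg {
  subalg_vs :> {vspace L};
  subalg_closed : forall x y,
    x \in subalg_vs -> y \in subalg_vs -> lie x y \in subalg_vs
}.

Definition lie_center (k : lieSubalg) : set L :=
  [set x | x \in k /\ forall y, y \in k -> lie x y = 0].

Local Notation dual := 'Hom(L, F^o).

(* phi vanishes on U iff its composite with a projection onto U is 0. *)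
Definition restr_proj U (phi : dual) : dual := (phi \o projv U)%VF.

Fact restr_proj_is_linear U : linear (restr_proj U).
Proof. by move=> c f g; rewrite /restr_proj comp_lfunDl comp_lfunZl. Qed.
HB.instance Definition _ U := GRing.isSemilinear.Build F _ _ _ (restr_proj U)
  (GRing.semilinear_linear (restr_proj_is_linear U)).

Definition annihilator U : {vspace dual} := lker (linfun (restr_proj U)).

Lemma annihilatorP U (phi : dual) :
  reflect (forall x, x \in U -> phi x = 0) (phi \in annihilator U).
Proof.
rewrite memv_ker lfunE /= /restr_proj; apply: (iffP eqP) => [h x xU|h].
  by have /lfunP/(_ x) := h; rewrite comp_lfunE projv_id // zero_lfunE.
by apply/lfunP => x; rewrite comp_lfunE zero_lfunE h // memv_proj.
Qed.

Definition coad x (phi : dual) : dual := - (phi \o ad x)%VF.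

Lemma coadE x (phi : dual) y : coad x phi y = - phi (lie x y).
Proof. by rewrite /coad opp_lfunE comp_lfunE adE. Qed.

Lemma coad_annihilator (k : lieSubalg) x (phi : dual) :
  x \in k -> phi \in annihilator k -> coad x phi \in annihilator k.
Proof.
move=> xk /annihilatorP phi0; apply/annihilatorP => y yk.
by rewrite coadE phi0 ?oppr0 // subalg_closed.
Qed.

Definition coad_semidirect (k : lieSubalg) : Type :=
  (subvs_of (annihilator k) * subvs_of k)%type.

HB.instance Definition _ (k : lieSubalg) :=
  Vector.copy (coad_semidirect k) (subvs_of (annihilator k) * subvs_of k)%type.

Section Semidirect.
Variable k : lieSubalg.
Implicit Types u v w : coad_semidirect k.

(* [phi + x, psi + y] = ad^v(x)(psi) - ad^v(y)(phi) + [x, y].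
   On these arguments vsproj is only a repackaging: by coad_annihilator and
   subalg_closed the projected vectors already lie in the subspace. *)
Definition semidirect_bracket u v : coad_semidirect k :=
  (vsproj (annihilator k)
     (coad (vsval u.2) (vsval v.1) - coad (vsval v.2) (vsval u.1)),
   vsproj k (lie (vsval u.2) (vsval v.2))).

Lemma semidirect_bracket1 u v :
  vsval (semidirect_bracket u v).1 =
    coad (vsval u.2) (vsval v.1) - coad (vsval v.2) (vsval u.1).
Proof. by rewrite /= vsprojK // memvB // coad_annihilator // subvsP. Qed.

Lemma semidirect_bracket2 u v :
  vsval (semidirect_bracket u v).2 = lie (vsval u.2) (vsval v.2).
Proof. by rewrite /= vsprojK // subalg_closed // subvsP. Qed.

Lemma semidirect_eqP u v :
  (forall x, vsval u.1 x = vsval v.1 x) -> vsval u.2 = vsval v.2 -> u = v.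
Proof.
case: u v => [f x] [g y] /= /lfunP/val_inj -> xy; congr pair; exact/val_inj.
Qed.

Lemma semidirect_bracket1E u v x : vsval (semidirect_bracket u v).1 x =
  vsval u.1 (lie (vsval v.2) x) - vsval v.1 (lie (vsval u.2) x).
Proof.
by rewrite semidirect_bracket1 add_lfunE coadE opp_lfunE coadE opprK addrC.
Qed.

Lemma semidirect_lin1 c u w x : vsval (c *: u + w).1 x =
  c * vsval u.1 x + vsval w.1 x.
Proof. by rewrite /= add_lfunE scale_lfunE. Qed.

Lemma semidirect_lin2 c u w : vsval (c *: u + w).2 =
  c *: vsval u.2 + vsval w.2.
Proof. by []. Qed.

Fact semidirect_linearl v : linear (semidirect_bracket^~ v).
Proof.
move=> c u w; apply: semidirect_eqP => [x|].
  rewrite semidirect_lin1 !semidirect_bracket1E semidirect_lin1 semidirect_lin2.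
  rewrite lieDl lieZl linearP mulrBr opprD !addrA.
  by congr (_ - _); rewrite addrAC.
by rewrite semidirect_lin2 !semidirect_bracket2 semidirect_lin2 lieDl lieZl.
Qed.

Fact semidirect_linearr v : linear (semidirect_bracket v).
Proof.
move=> c u w; apply: semidirect_eqP => [x|].
  rewrite semidirect_lin1 !semidirect_bracket1E semidirect_lin1 semidirect_lin2.
  rewrite lieDl lieZl linearP mulrBr opprD !addrA.
  by congr (_ - _); rewrite addrAC.
by rewrite semidirect_lin2 !semidirect_bracket2 semidirect_lin2 linearP.
Qed.

Fact semidirect_xx v : semidirect_bracket v v = 0.
Proof.
apply: semidirect_eqP => [x|]; last by rewrite semidirect_bracket2 liexx.
by rewrite semidirect_bracket1E subrr zero_lfunE.
Qed.

Fact semidirect_jacobi u v w :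
  semidirect_bracket u (semidirect_bracket v w)
  + semidirect_bracket v (semidirect_bracket w u)
  + semidirect_bracket w (semidirect_bracket u v) = 0.
Proof.
have sum3 (a b c : coad_semidirect k) : a + b + c = 1 *: (1 *: a + b) + c.
  by rewrite !scale1r.
rewrite sum3; apply: semidirect_eqP => [x|]; last first.
  rewrite !semidirect_lin2 !semidirect_bracket2 !scale1r lie_jacobi //.
rewrite !semidirect_lin1 !semidirect_bracket1E !semidirect_bracket2 !mul1r.
rewrite !lie_jacobi_act !raddfB /= zero_lfunE.
set f := vsval u.1; set g := vsval v.1; set h := vsval w.1.
ring.
Qed.

HB.instance Definition _ := Vector_isLieAlgebra.Build F (coad_semidirect k)
  semidirect_linearl semidirect_linearr semidirect_xx semidirect_jacobi.

End Semidirect.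
End LieTheory.

Section Tensor.
Variables (F : fieldType) (V : vectType F).
Implicit Types (v w : V) (t : 'M[F]_(\dim {:V})).
Local Notation b := (vbasis {:V}).

(* V (x) V in coordinates: with b = vbasis {:V}, the matrix t stands for
   \sum_ij t i j *: (b_i (x) b_j). *)
Definition tens v w : 'M[F]_(\dim {:V}) := (rVof b v)^T *m rVof b w.

(* f (x) g as an operator on V (x) V, see tens_mapE *)
Definition tens_map (f g : 'End(V)) t := (mxof b b f)^T *m t *m mxof b b g.

Lemma tens_mapE f g v w : tens_map f g (tens v w) = tens (f v) (g w).
Proof.
have app (h : 'End(V)) u : rVof b (h u) = rVof b u *m mxof b b h.
  by apply: rVof_app; exact: vbasisP.
by rewrite /tens_map /tens !app trmx_mul !mulmxA.
Qed.

(* the pairing <t, f (x) g>, see tens_evalE *)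
Definition tens_eval (f g : 'Hom(V, F^o)) t : F :=
  \sum_i \sum_j t i j * f b`_i * g b`_j.

Lemma tens_evalE (f g : 'Hom(V, F^o)) v w :
  tens_eval f g (tens v w) = f v * g w.
Proof.
have bV : basis_of {:V} b := vbasisP _.
rewrite {2}(coord_basis bV (memvf v)) {2}(coord_basis bV (memvf w)).
rewrite !linear_sum /= mulr_suml; apply: eq_bigr => i _.
rewrite mulr_sumr; apply: eq_bigr => j _.
rewrite !linearZ /= /tens !mxE big_ord1 !mxE /GRing.scale /=.
ring.
Qed.

Lemma tens_evalD f g t t' :
  tens_eval f g (t + t') = tens_eval f g t + tens_eval f g t'.
Proof.
rewrite /tens_eval -big_split; apply: eq_bigr => i _ /=.
by rewrite -big_split; apply: eq_bigr => j _ /=; rewrite mxE !mulrDl.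
Qed.

Lemma tens_evalZ f g c t : tens_eval f g (c *: t) = c * tens_eval f g t.
Proof.
rewrite /tens_eval mulr_sumr; apply: eq_bigr => i _ /=.
by rewrite mulr_sumr; apply: eq_bigr => j _ /=; rewrite mxE !mulrA.
Qed.

Definition wedge v w := tens v w - tens w v.

(* The second exterior power as a subspace of V (x) V: the transpose is the
   flip v (x) w |-> w (x) v. *)
Definition wedge2 t : Prop := t^T = - t.

Lemma wedge2_wedge v w : wedge2 (wedge v w).
Proof. by rewrite /wedge2 /wedge linearB /= !trmx_mul !trmxK opprB. Qed.

End Tensor.

Section Coboundary.
Variables (F : fieldType) (L : lieAlgType F).
Implicit Types (x : L) (t r : 'M[F]_(\dim {:L})).

(* the action x.t of x on t *)
Definition tens_act x t := tens_map (ad x) \1%VF t + tens_map \1%VF (ad x) t.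

(* [t, Delta(x)], computed in U(L) (x) U(L), lies in L (x) L and is - x.t *)
Definition comm_Delta t x := - tens_act x t.

Definition coboundary_with (delta : L -> 'M[F]_(\dim {:L})) r : Prop :=
  wedge2 r /\ forall x, delta x = comm_Delta r x.

Definition coboundary (delta : L -> 'M[F]_(\dim {:L})) : Prop :=
  exists r, coboundary_with delta r.

End Coboundary.

Section Cobracket.
Variables (F : fieldType) (L : lieAlgType F) (k : lieSubalg L).
Variables (s : {vspace L}) (m : nat) (y : m.-tuple L).
Local Notation dual := 'Hom(L, F^o).
Local Notation e := (coad_semidirect k).

Definition inA (phi : dual) : e := (vsproj (annihilator k) phi, 0).
Definition inK (x : L) : e := (0, vsproj k x).

(* When L = k (+) s: the projection onto k along s, and, for a basis y of s,
   the dual basis of k^0 (the i-th coordinate of the projection onto s). *)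
Definition proj_k : 'End(L) := daddv_pi k s.
Definition dual_basis (i : 'I_m) : dual :=
  linfun (coord y i \o daddv_pi s k : L -> F^o).

Definition cobracket (u : e) : 'M[F]_(\dim {:e}) :=
  \sum_(i < m) wedge (inK (proj_k (lie y`_i (vsval u.2)))) (inA (dual_basis i))
  + \sum_(i < m) \sum_(j < m)
      vsval u.1 (lie y`_i y`_j) *: tens (inA (dual_basis i)) (inA (dual_basis j)).

(* <., y0> on k^0, extended by 0 on k *)
Definition ann_fun (y0 : L) (u : e) : F^o := vsval u.1 y0.

Fact ann_fun_is_linear y0 : linear (ann_fun y0).
Proof. by move=> c u v; rewrite /ann_fun /= add_lfunE scale_lfunE. Qed.
HB.instance Definition _ y0 := GRing.isSemilinear.Build F _ _ _ (ann_fun y0)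
  (GRing.semilinear_linear (ann_fun_is_linear y0)).

Definition ann_eval (y0 : L) : 'Hom(e, F^o) := linfun (ann_fun y0).

Hypothesis ks0 : (k :&: s = 0)%VS.
Hypothesis ys : basis_of s y.

Lemma dual_basis_ann i : dual_basis i \in annihilator k.
Proof.
apply/annihilatorP => x xk; rewrite lfunE /=.
have xks : x \in (k + s)%VS by apply: subvP xk; exact: addvSl.
have := daddv_pi_add ks0 xks; rewrite daddv_pi_id // => /eqP.
by rewrite -[X in _ == X]addr0 (inj_eq (addrI x)) => /eqP ->; rewrite linear0.
Qed.

Lemma dual_basis_coord i x : x \in s -> dual_basis i x = coord y i x.
Proof. by move=> xs; rewrite lfunE /= daddv_pi_id ?(capvC s). Qed.

Lemma dual_basisE (i j : 'I_m) : dual_basis i y`_j = (i == j)%:R.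
Proof.
rewrite dual_basis_coord; first by rewrite coord_free ?(basis_free ys) // eq_sym.
by apply: (basis_mem ys); apply/mem_nth; rewrite size_tuple.
Qed.

(* The restriction of the cobracket to k^0 is the transpose of the bracket of
   s. *)
Lemma cobracket_annE (psi : dual) y0 y1 : psi \in annihilator k ->
  y0 \in s -> y1 \in s ->
  tens_eval (ann_eval y0) (ann_eval y1) (cobracket (inA psi)) = psi (lie y0 y1).
Proof.
move=> psiA y0s y1s; rewrite /cobracket big1 ?add0r => [|i _]; last first.
  rewrite /= !linear0 /inK linear0 /wedge /tens.
  by rewrite [X in rVof _ X](_ : _ = 0) // linear0 trmx0 mul0mx mulmx0 subr0.
rewrite [in RHS](coord_basis ys y0s) [in RHS](coord_basis ys y1s).
have evsum (I : finType) (G : I -> 'M[F]_(\dim {:e})) :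
    tens_eval (ann_eval y0) (ann_eval y1) (\sum_i G i) =
    \sum_i tens_eval (ann_eval y0) (ann_eval y1) (G i).
  elim/big_rec2: _ => [|i a t _ <-]; last by rewrite tens_evalD.
  by rewrite -(scale0r 0) tens_evalZ mul0r.
rewrite evsum (big_morph (lie^~ _) (fun a b => lieDl _ a b) (lie0l _)).
rewrite linear_sum; apply: eq_bigr => i _.
rewrite evsum lieZl linearZ linear_sum linear_sum /= scaler_sumr.
apply: eq_bigr => j _; rewrite tens_evalZ tens_evalE /inA !lfunE /= /ann_fun /=.
rewrite !vsprojK ?dual_basis_ann // !dual_basis_coord // !linearZ /=.
by rewrite /GRing.scale /=; ring.
Qed.

End Cobracket.

Arguments inA {F L} k phi.
Arguments inK {F L} k x.
Arguments cobracket {F L} k s {m} y u.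

Section Smooth.
Variables (R : realType) (V W : normedModType R).

Fixpoint Ck (j : nat) (D : set V) (f : V -> W) : Prop :=
  match j with
  | 0 => forall x, D x -> {for x, continuous f}
  | j'.+1 => (forall x, D x -> differentiable f x) /\
             forall v, Ck j' D (fun x => 'D_v f x)
  end.

(* meant for open D *)
Definition smooth_on (D : set V) (f : V -> W) : Prop := forall j, Ck j D f.

End Smooth.

Record chart (V X : topologicalType) := Chart {
  chart_dom : set X;
  chart_img : set V;
  chart_fun : X -> V;
  chart_inv : V -> X;
  chart_dom_open : open chart_dom;
  chart_img_open : open chart_img;
  chart_funS : forall x, chart_dom x -> chart_img (chart_fun x);
  chart_invS : forall v, chart_img v -> chart_dom (chart_inv v);
  chart_funK : forall x, chart_dom x -> chart_inv (chart_fun x) = x;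
  chart_invK : forall v, chart_img v -> chart_fun (chart_inv v) = v;
  chart_fun_cts : forall x, chart_dom x -> {for x, continuous chart_fun};
  chart_inv_cts : forall v, chart_img v -> {for v, continuous chart_inv}
}.

(* A Lie group of dimension n, with an atlas (lg_chart h)_h. Second
   countability is not imposed: it is automatic when the group is connected. *)
HB.mixin Record isLieGroup (R : realType) (n : nat) G
    of Topological G & Group G := {
  lg_hausdorff : hausdorff_space G;
  lg_mul_cts : continuous (fun x : G * G => (x.1 * x.2)%g);
  lg_inv_cts : continuous (fun x : G => (x^-1)%g);
  lg_chart : G -> chart 'rV[R]_n G;
  lg_chart_dom : forall h, chart_dom (lg_chart h) h;
  lg_transition_smooth : forall h h' : G,
    smooth_on
      [set u | chart_img (lg_chart h) u /\
               chart_dom (lg_chart h') (chart_inv (lg_chart h) u)]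
      (fun u => chart_fun (lg_chart h') (chart_inv (lg_chart h) u));
  lg_mul_smooth : forall h h' h'' : G,
    smooth_on
      [set u : 'rV[R]_n * 'rV[R]_n |
        [/\ chart_img (lg_chart h) u.1, chart_img (lg_chart h') u.2 &
            chart_dom (lg_chart h'')
              (chart_inv (lg_chart h) u.1 * chart_inv (lg_chart h') u.2)%g]]
      (fun u => chart_fun (lg_chart h'')
        (chart_inv (lg_chart h) u.1 * chart_inv (lg_chart h') u.2)%g);
  lg_inv_smooth : forall h h' : G,
    smooth_on
      [set u | chart_img (lg_chart h) u /\
               chart_dom (lg_chart h') (chart_inv (lg_chart h) u)^-1%g]
      (fun u => chart_fun (lg_chart h') (chart_inv (lg_chart h) u)^-1%g)
}.

#[short(type="lieGroupType")]
HB.structure Definition LieGroup (R : realType) (n : nat) :=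
  {G of Topological G & Group G & isLieGroup R n G}.

Section LieGroupTheory.
Variables (R : realType) (n : nat) (G : lieGroupType R n).
Implicit Types H K : set G.

Definition center_of H : set G :=
  [set z | H z /\ forall h, H h -> (z * h = h * z)%g].

Definition is_subgroup H : Prop :=
  H 1%g /\ forall x y, H x -> H y -> H (x * y^-1)%g.

Definition compact_subgroup H : Prop := is_subgroup H /\ compact H.

Definition maximal_compact_subgroup K : Prop :=
  compact_subgroup K /\
  forall H, compact_subgroup H -> K `<=` H -> H = K.

Definition discrete_subset H : Prop := H `<=` isolated H.

(* The tangent space at the identity is 'rV[R]_n through the chart at 1, in
   which the multiplication is chart_mul and the left-invariant vector field
   with value v at the identity is left_field v; the bracket of tangent vectors
   is the value at the identity of the bracket of these vector fields. *)
Local Notation c1 := (lg_chart (1%g : G)).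

Definition chart_mul (u v : 'rV[R]_n) : 'rV[R]_n :=
  chart_fun c1 (chart_inv c1 u * chart_inv c1 v)%g.

Definition left_field (v u : 'rV[R]_n) : 'rV[R]_n :=
  'D_v (chart_mul u) (chart_fun c1 1%g).

Definition tangent_bracket (u v : 'rV[R]_n) : 'rV[R]_n :=
  'D_u (left_field v) (chart_fun c1 1%g) -
  'D_v (left_field u) (chart_fun c1 1%g).

Definition one_parameter_subgroup (c : R -> G) : Prop :=
  continuous c /\ forall t t', c (t + t') = (c t * c t')%g.

Definition velocity (c : R -> G) (u : 'rV[R]_n) : Prop :=
  is_derive (0 : R) 1 (chart_fun c1 \o c) u.

Variables (g : lieAlgType R) (tau : {linear g -> 'rV[R]_n}).

(* tau identifies g with the Lie algebra of G *)
Definition is_lie_algebra_of : Prop :=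
  bijective tau /\
  forall x y : g, tau (lie x y) = tangent_bracket (tau x) (tau y).

(* exp_rel x h : exp x = h *)
Definition exp_rel (x : g) (h : G) : Prop :=
  exists c, [/\ one_parameter_subgroup c, velocity c (tau x) & c 1 = h].

Definition exp_image (U : {vspace g}) : set G :=
  [set h | exists2 x, x \in U & exp_rel x h].

(* U = {x | exp (t x) \in H for all t} *)
Definition is_lie_algebra_of_subgroup H (U : {vspace g}) : Prop :=
  forall x, x \in U <->
    exists c, [/\ one_parameter_subgroup c, velocity c (tau x) &
                  forall t, H (c t)].

End LieGroupTheory.

Section Decompositions.
Variables (R : realType) (g : lieAlgType R).
Implicit Types (k p a : {vspace g}).

Record cartan_decomposition k p : Prop := {
  cartan_sum : (k + p = fullv)%VS;
  cartan_cap : (k :&: p = 0)%VS;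
  cartan_kk : forall x y, x \in k -> y \in k -> lie x y \in k;
  cartan_kp : forall x y, x \in k -> y \in p -> lie x y \in p;
  cartan_pp : forall x y, x \in p -> y \in p -> lie x y \in k;
  cartan_orth : forall x y, x \in k -> y \in p -> killing_form x y = 0;
  cartan_neg : forall x, x \in k -> x != 0 -> killing_form x x < 0;
  cartan_pos : forall x, x \in p -> x != 0 -> 0 < killing_form x x
}.

Definition abelian_subspace a : Prop :=
  forall x y, x \in a -> y \in a -> lie x y = 0.

Definition maximal_abelian_in p a : Prop :=
  [/\ (a <= p)%VS, abelian_subspace a &
      forall b : {vspace g},
        (b <= p)%VS -> abelian_subspace b -> (a <= b)%VS -> b = a].

(* A notion of positivity on the dual of a, i.e. a vector space ordering. *)
Definition positivity a (pos : set 'Hom(subvs_of a, R^o)) : Prop :=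
  [/\ ~ pos 0,
      forall l, l != 0 -> pos l \/ pos (- l),
      forall l, pos l -> ~ pos (- l),
      forall l l', pos l -> pos l' -> pos (l + l') &
      forall (c : R) l, 0 < c -> pos l -> pos (c *: l)].

Definition root_vector a (l : 'Hom(subvs_of a, R^o)) : set g :=
  [set x | forall h : subvs_of a, lie (vsval h) x = (l h : R) *: x].

(* U is the sum of the root spaces of the positive roots. *)
Definition sum_positive_root_spaces a
    (pos : set 'Hom(subvs_of a, R^o)) (U : {vspace g}) : Prop :=
  let contains (U' : {vspace g}) :=
    forall l x, pos l -> root_vector l x -> x \in U' in
  contains U /\ forall U', contains U' -> (U <= U')%VS.

End Decompositions.

(* G = KAN and g = k (+) a (+) n *)
Record iwasawa_decomposition (R : realType) (n : nat) (G : lieGroupType R n)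
    (g : lieAlgType R) (tau : {linear g -> 'rV[R]_n})
    (K A N : set G) (k p a nn : {vspace g}) : Prop := {
  iwasawa_a : maximal_abelian_in p a;
  iwasawa_n : exists2 pos : set 'Hom(subvs_of a, R^o),
    positivity pos & sum_positive_root_spaces pos nn;
  iwasawa_A : A = exp_image tau a;
  iwasawa_N : N = exp_image tau nn;
  iwasawa_group : forall h : G,
    exists! q : G * G * G,
      [/\ K q.1.1, A q.1.2, N q.2 & h = (q.1.1 * q.1.2 * q.2)%g];
  iwasawa_sum : (k + a + nn = fullv)%VS;
  iwasawa_direct : directv (k + a + nn)
}.

(* Main.v *)
(* Let theta be the projection of g onto k along p. The Cartan decomposition
   alone already yields an r-matrix, r = \sum_i theta(y_i) /\ psi^i: on k
   because theta commutes with ad(k), and on k^0 because psi [y, y'] =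
   psi [theta y, y'] + psi [y, theta y'] when psi vanishes on k, as [p, p] <= k.
   The element z acts trivially on k, and with square -1 on k^0, so that
   z.(z.r) = - r and hence z.delta(z) = r. *)

Require Import Defs.
From HB Require Import structures.
From mathcomp Require Import all_boot all_order all_algebra.
From mathcomp Require Import all_classical all_reals all_analysis.

Set Implicit Arguments.
Unset Strict Implicit.
Unset Printing Implicit Defensive.

Import Order.TTheory GRing.Theory Num.Theory.
Import numFieldNormedType.Exports.
Import passmx.

Local Open Scope classical_set_scope.
Local Open Scope ring_scope.

(** * Bilinearity of wedges and of tensor maps *)

Section Wedge.
Variables (F : fieldType) (V : vectType F).
Implicit Types v w : V.

Fact wedge_is_linear v : linear (wedge v).
Proof.
move=> c u w; rewrite /wedge /tens !linearP /= mulmxDl -scalemxAl.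
by rewrite scalerBr opprD !addrA; congr (_ - _); rewrite addrAC.
Qed.
HB.instance Definition _ v := GRing.isSemilinear.Build F _ _ _ (wedge v)
  (GRing.semilinear_linear (wedge_is_linear v)).

(** Antisymmetry carries the registered linearity in the second argument over to the first. *)
Lemma wedgeC v w : wedge v w = - wedge w v.
Proof. by rewrite /wedge opprB. Qed.

Lemma wedgeDl v v' w : wedge (v + v') w = wedge v w + wedge v' w.
Proof. by rewrite !(wedgeC _ w) [wedge w _]linearD opprD. Qed.

Lemma wedgeNl v w : wedge (- v) w = - wedge v w.
Proof. by rewrite !(wedgeC _ w) [wedge w (- _)]linearN. Qed.

Lemma wedgeZl c v w : wedge (c *: v) w = c *: wedge v w.
Proof. by rewrite !(wedgeC _ w) [wedge w _]linearZ scalerN. Qed.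

Lemma wedge_suml (I : finType) (f : I -> V) w :
  wedge (\sum_i f i) w = \sum_i wedge (f i) w.
Proof.
rewrite wedgeC [wedge w _]linear_sum -sumrN.
by apply: eq_bigr => i _; rewrite [RHS]wedgeC.
Qed.

Lemma wedge2_sum (I : finType) (f : I -> 'M[F]_(\dim {:V})) :
  (forall i, wedge2 (f i)) -> wedge2 (\sum_i f i).
Proof.
by move=> h; rewrite /wedge2 linear_sum -sumrN; apply: eq_bigr => i _; apply: h.
Qed.

Fact tens_map_is_linear (f g : 'End(V)) : linear (tens_map f g).
Proof.
by move=> c t t'; rewrite /tens_map mulmxDr mulmxDl -scalemxAr -scalemxAl.
Qed.
HB.instance Definition _ (f g : 'End(V)) :=
  GRing.isSemilinear.Build F _ _ _ (tens_map f g)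
  (GRing.semilinear_linear (tens_map_is_linear f g)).

End Wedge.

(** * The action of a Lie algebra on its tensors *)

Section TensorAction.
Variables (F : fieldType) (L : lieAlgType F).
Implicit Types x v w : L.

Lemma lieBl v v' w : lie (v - v') w = lie v w - lie v' w :> L.
Proof. by rewrite lieDl -scaleN1r lieZl scaleN1r. Qed.

Fact tens_act_is_linear x : linear (tens_act x).
Proof.
move=> c t t'; rewrite /tens_act !linearP /= scalerDr !addrA; congr (_ + _).
by rewrite addrAC.
Qed.
HB.instance Definition _ x := GRing.isSemilinear.Build F _ _ _ (tens_act x)
  (GRing.semilinear_linear (tens_act_is_linear x)).

(** [tens_mapE] turns each summand of the action into a bracket in one leg; the four resulting terms
    regroup into two wedges. *)
Lemma tens_act_wedge x v w :
  tens_act x (wedge v w) = wedge (lie x v) w + wedge v (lie x w).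
Proof.
rewrite /wedge linearB /= /tens_act !tens_mapE !id_lfunE !adE.
by rewrite [RHS]addrACA -opprD [X in _ - X]addrC.
Qed.

End TensorAction.

(** * The two embeddings into $\mathfrak{k}^0 \rtimes \mathfrak{k}$ *)

Section CartanRMatrix.
Variables (F : fieldType) (L : lieAlgType F) (k : lieSubalg L).
Local Notation dual := 'Hom(L, F^o).
Local Notation e := (coad_semidirect k).
Implicit Types (phi : dual) (u : e).

Fact inA_is_linear : linear (inA k : dual -> e).
Proof.
by move=> c f g; rewrite /inA linearP; congr pair; rewrite /= scaler0 addr0.
Qed.
HB.instance Definition _ := GRing.isSemilinear.Build F _ _ _ (inA k : dual -> e)
  (GRing.semilinear_linear inA_is_linear).

Fact inK_is_linear : linear (inK k : L -> e).
Proof.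
by move=> c f g; rewrite /inK linearP; congr pair; rewrite /= scaler0 addr0.
Qed.
HB.instance Definition _ := GRing.isSemilinear.Build F _ _ _ (inK k : L -> e)
  (GRing.semilinear_linear inK_is_linear).

Lemma lie_inK u x : x \in k ->
  lie u (inK k x) = inK k (lie (vsval u.2) x) - inA k (coad x (vsval u.1)).
Proof.
move=> xk; apply: semidirect_eqP => [v|].
  rewrite [LHS]semidirect_bracket1E /= zero_lfunE subr0 sub0r opp_lfunE.
  by rewrite !vsprojK ?coad_annihilator ?subvsP // coadE opprK.
rewrite [LHS]semidirect_bracket2 /= subr0 !vsprojK //.
by rewrite Defs.subalg_closed ?subvsP.
Qed.

Lemma lie_inA u phi : phi \in annihilator k ->
  lie u (inA k phi) = inA k (coad (vsval u.2) phi).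
Proof.
move=> phi0; apply: semidirect_eqP => [v|].
  rewrite [LHS]semidirect_bracket1E /= lie0l linear0 sub0r.
  by rewrite !vsprojK ?coad_annihilator ?subvsP // coadE.
by rewrite [LHS]semidirect_bracket2 /= linear0.
Qed.

(** * Iwasawa and Cartan projections, and the r-matrix built from them *)

Variables (s p : {vspace L}) (m : nat) (y : m.-tuple L).
Hypothesis ks : (k + s = fullv)%VS.
Hypothesis ks0 : (k :&: s = 0)%VS.
Hypothesis ys : basis_of s y.
Hypothesis kp : (k + p = fullv)%VS.
Hypothesis kp0 : (k :&: p = 0)%VS.
Hypothesis kpS : forall x v, x \in k -> v \in p -> lie x v \in p.
Hypothesis ppS : forall x v, x \in p -> v \in p -> lie x v \in k.

Local Notation psi := (dual_basis k s y).
Local Notation theta := (daddv_pi k p).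

Lemma sum_dual_basis x : \sum_i (psi i x : F) *: y`_i = daddv_pi s k x.
Proof.
rewrite [RHS](coord_basis ys (memv_pi _ _ _)).
by apply: eq_bigr => i _; rewrite lfunE.
Qed.

Lemma proj_kE x : proj_k k s x = x - \sum_i (psi i x : F) *: y`_i.
Proof.
by rewrite sum_dual_basis -{2}(daddv_pi_add ks0 (w := x)) ?ks ?memvf // addrK.
Qed.

(** A form killing [k] sees only the component along [s], which [sum_dual_basis] expands in the
    basis [y]. *)
Lemma annihilator_dual_basis phi : phi \in annihilator k ->
  phi = \sum_(i < m) (phi y`_i : F) *: psi i.
Proof.
move=> /annihilatorP phi0; apply/lfunP => x.
rewrite -[in LHS](subrK (\sum_i (psi i x : F) *: y`_i) x) -proj_kE linearD /=.
rewrite phi0 ?memv_pi // add0r linear_sum sum_lfunE; apply: eq_bigr => i _.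
by rewrite linearZ scale_lfunE; apply: mulrC.
Qed.

Lemma cartan_projB x : x - theta x \in p.
Proof.
by rewrite -{1}(daddv_pi_add kp0 (w := x)) ?kp ?memvf // addrC addKr memv_pi.
Qed.

(** Both [k] and [p] are stable under [lie x], so [lie x] respects the Cartan splitting. *)
Lemma cartan_proj_lie x v : x \in k -> theta (lie x v) = lie x (theta v).
Proof.
move=> xk; have tvk := memv_pi k p v.
rewrite -{1}(subrK (theta v) v) [lie x (_ + _)]linearD linearD /=.
rewrite [theta (lie x (theta v))]daddv_pi_id ?Defs.subalg_closed //.
rewrite [X in X + _](_ : _ = 0) ?add0r //.
have ps := kpS xk (cartan_projB v).
have := daddv_pi_add kp0 (w := lie x (v - theta v)).
rewrite kp memvf [daddv_pi p k _]daddv_pi_id ?(capvC p) // => /(_ isT).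
by move/(canRL (addrK _)); rewrite subrr.
Qed.

(** Expand [lie (v - theta v) (w - theta w)], which lies in $[p, p] \subset k$. It and
    [lie (theta v) (theta w)] are both killed by [phi]. *)
Lemma annihilator_lie phi v w : phi \in annihilator k ->
  phi (lie v w) = phi (lie (theta v) w) + phi (lie v (theta w)).
Proof.
move=> /annihilatorP phi0.
have -> : lie v w = lie (theta v) w + (lie v (theta w)
    - lie (theta v) (theta w) + lie (v - theta v) (w - theta w)).
  by rewrite linearB /= !lieBl addrC [X in X + _]addrC subrK subrK.
rewrite 2!linearD linearB /=.
rewrite (phi0 (lie (theta v) (theta w))) ?(phi0 (lie (v - _) _)).
- by rewrite subr0 addr0.
- exact/ppS/cartan_projB/cartan_projB.
- by rewrite Defs.subalg_closed ?memv_pi.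
Qed.

(** Under the duality of $s$ and $k^0$, this is the antisymmetrized tensor of [theta] restricted to
    [s]. *)
Definition cartan_r := \sum_(i < m) wedge (inK k (theta y`_i)) (inA k (psi i)).

Lemma wedge2_cartan_r : wedge2 cartan_r.
Proof. by apply: wedge2_sum => i; apply: wedge2_wedge. Qed.

(** Since $k^0$ is abelian, the $k^0$-component of [u] acts on the $k$-legs only: this is the middle
    sum. *)
Lemma tens_act_cartan_r u : tens_act u cartan_r =
  \sum_(i < m) wedge (inK k (lie (vsval u.2) (theta y`_i))) (inA k (psi i))
  - \sum_(i < m) wedge (inA k (coad (theta y`_i) (vsval u.1))) (inA k (psi i))
  + \sum_(i < m) wedge (inK k (theta y`_i)) (inA k (coad (vsval u.2) (psi i))).
Proof.
rewrite linear_sum -sumrB -big_split; apply: eq_bigr => i _ /=.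
rewrite tens_act_wedge lie_inK ?memv_pi // lie_inA ?dual_basis_ann //.
by rewrite wedgeDl wedgeNl.
Qed.

(** Transposition: [coad x (psi i)] has coefficient [- psi i (lie x y_j)] at [psi j], and exchanging
    the sums moves it to the other leg. The inner sum is then the [s]-component of [lie x y_j]. *)
Lemma sum_wedge_coad (x : L) (f : {linear L -> e}) : x \in k ->
  \sum_(i < m) wedge (f y`_i) (inA k (coad x (psi i))) =
  - \sum_(j < m) wedge (f (\sum_i (psi i (lie x y`_j) : F) *: y`_i))
      (inA k (psi j)).
Proof.
move=> xk.
under eq_bigr => i _.
  have cA := coad_annihilator xk (dual_basis_ann y ks0 i).
  rewrite (annihilator_dual_basis cA).
  rewrite !linear_sum; over.
rewrite exchange_big -sumrN; apply: eq_bigr => j _ /=.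
rewrite linear_sum wedge_suml -sumrN; apply: eq_bigr => i _.
by rewrite !linearZ /= wedgeZl coadE scaleNr.
Qed.

Lemma cobracket_cartan_r u : cobracket k s y u = - tens_act u cartan_r.
Proof.
rewrite tens_act_cartan_r (sum_wedge_coad (inK k \o theta)) ?subvsP //.
set phi := vsval u.1; set x := vsval u.2.
have phiA : phi \in annihilator k by exact: subvsP.
have xk : x \in k by exact: subvsP.
rewrite /cobracket -/phi -/x !opprD !opprK addrAC; congr (_ + _).
  rewrite -sumrN -big_split; apply: eq_bigr => i _ /=.
  rewrite -wedgeNl -wedgeDl -linearN -linearD; congr (wedge (inK k _) _).
  (* [theta] fixes the Iwasawa component of [lie y_i x], which lies in [k]. Inserting it there lets
     [theta] commute with [lie x]. *)
  have <- := daddv_pi_id kp0 (memv_pi k s (lie y`_i x)).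
  rewrite lieC linearN /= [daddv_pi k s _]proj_kE linearN linearB /=.
  by rewrite cartan_proj_lie // opprB addrC.
pose t i j := tens (inA k (psi i)) (inA k (psi j)).
pose c (i j : 'I_m) : F := phi (lie (theta y`_i) y`_j).
(* By [annihilator_lie], [phi (lie y_i y_j)] is [c i j - c j i]; the antisymmetry is moved from [c]
   to the tensors by swapping indices. *)
transitivity (\sum_i \sum_j (c i j *: t i j - c i j *: t j i)).
  under [RHS]eq_bigr do rewrite sumrB.
  rewrite sumrB [X in _ - X]exchange_big -sumrB; apply: eq_bigr => i _.
  rewrite -sumrB; apply: eq_bigr => j _.
  by rewrite annihilator_lie // (lieC y`_i) linearN scalerBl.
apply: eq_bigr => i _.
have cA := coad_annihilator (memv_pi k p y`_i) phiA.
rewrite (annihilator_dual_basis cA) linear_sum wedge_suml.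
apply: eq_bigr => j _.
rewrite [X in wedge X _]linearZ /= wedgeZl coadE.
by rewrite scaleNr -scalerN opprB scalerBr.
Qed.

Lemma tens_act_cartan_r2 (z : L) : z \in k ->
  (forall x, x \in k -> lie z x = 0) ->
  (forall x, x \in p -> lie z (lie z x) = - x) ->
  tens_act (inK k z) (tens_act (inK k z) cartan_r) = - cartan_r.
Proof.
move=> zk zk0 zp.
(* [z] kills the $k$-legs, so only the other legs change. A general [f] lets the rule apply twice,
   to [psi] and then to [coad z] of it. *)
have act_sum (f : 'I_m -> dual) : (forall i, f i \in annihilator k) ->
    tens_act (inK k z) (\sum_(i < m) wedge (inK k (theta y`_i)) (inA k (f i))) =
    \sum_(i < m) wedge (inK k (theta y`_i)) (inA k (coad z (f i))).
  move=> fA; rewrite linear_sum; apply: eq_bigr => i _.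
  rewrite /= tens_act_wedge lie_inK ?memv_pi // lie_inA // /= vsprojK //.
  rewrite zk0 ?memv_pi // linear0 sub0r.
  rewrite [coad _ _](_ : _ = 0) ?linear0 ?oppr0.
    by rewrite wedgeC linear0 oppr0 add0r.
  by apply/lfunP => w; rewrite coadE !zero_lfunE oppr0.
have psiA i := dual_basis_ann y ks0 i.
rewrite !act_sum => [|i|//]; last exact: coad_annihilator.
rewrite -sumrN; apply: eq_bigr => i _; rewrite -linearN /= -linearN /=.
congr (wedge _ (inA k _)); apply/lfunP => x.
rewrite !coadE opprK opp_lfunE.
have /annihilatorP psi0 := psiA i.
(* Write [x] as [w + b] with [w] in [p] and [b] in [k]: [lie z] kills [b] and squares to -1 on [w],
   and [psi i] vanishes on [b]. *)
move: (subrK (theta x) x) (memv_pi k p x) (cartan_projB x).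
move: (theta x) (x - theta x) => b w <- bk wp.
rewrite [lie z (_ + _)]linearD /= (zk0 b) // addr0 zp // linearN linearD /=.
by rewrite (psi0 b) ?addr0.
Qed.

End CartanRMatrix.

(** * From the group data to the linear algebra *)

Theorem theorem4p1 (R : realType) (n : nat) (G : lieGroupType R n)
    (g : lieAlgType R) (tau : {linear g -> 'rV[R]_n})
    (K A N S : set G) (k : lieSubalg g) (p a nn s : {vspace g})
    (m : nat) (y : m.-tuple g)
    (g_lie : is_lie_algebra_of G tau)
    (G_connected : connected [set: G])
    (G_simple : lie_simple g)
    (G_finite_center : finite_set (center_of [set: G]))
    (K_maximal : maximal_compact_subgroup K)
    (K_center : ~ discrete_subset (center_of K))
    (k_lie : is_lie_algebra_of_subgroup tau K k)
    (kp_cartan : cartan_decomposition k p)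
    (KAN_iwasawa : iwasawa_decomposition tau K A N k p a nn)
    (S_def : S = [set (q.1 * q.2)%g | q in A `*` N])
    (s_lie : is_lie_algebra_of_subgroup tau S s)
    (s_def : s = (a + nn)%VS)
    (y_basis : basis_of s y) :
  coboundary (cobracket k s y) /\
  (forall z : g,
    lie_center k = [set c *: z | c in [set: R]] ->
    (forall x, x \in p -> lie z (lie z x) = - x) ->
    coboundary_with (cobracket k s y)
      (tens_act (inK k z) (cobracket k s y (inK k z)))).
Proof.
have [kp kp0 _ kpS ppS _ _ _] := kp_cartan.
have ks : (k + s = fullv)%VS by rewrite s_def addvA (iwasawa_sum KAN_iwasawa).
(* Dimension count: directness makes [k + s] as large as the three dimensions together, while [s]
   has at most the sum of those of [a] and [nn]. *)
have ks0 : (k :&: s = 0)%VS.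
  apply/eqP; rewrite -dimv_eq0 -leqn0 -(leq_add2l (\dim (k + s))) dimv_sum_cap.
  have := iwasawa_direct KAN_iwasawa.
  rewrite directvE /= -addvA -s_def => /eqP ->.
  by rewrite addn0 -addnA leq_add2l s_def dimv_add_leqif.
have dr := cobracket_cartan_r ks ks0 y_basis kp kp0 kpS ppS.
have rC : coboundary_with (cobracket k s y) (cartan_r k s p y).
  by split; first exact: wedge2_cartan_r.
split; first by exists (cartan_r k s p y).
move=> z zC zp.
(* The coefficient 1 puts [z] itself in the center. *)
have [zk zk0] : lie_center k z by rewrite zC; exists 1; rewrite // scale1r.
suff -> : tens_act (inK k z) (cobracket k s y (inK k z)) = cartan_r k s p y.
  by [].
by rewrite dr linearN /= (tens_act_cartan_r2 y ks0 kp kp0) // opprK.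
Qed.
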